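(* Let $\lambda_0$ be a triple eigenvalue of the Sturm--Liouville problem $-y''+q(x)y=\lambda y$ $(0<x<1)$, $y(0)\cos\beta=y'(0)\sin\beta$, $(a\lambda+b)y(1)=(c\lambda+d)y'(1)$, where $q$ is real-valued and continuous on $[0,1]$, $a,b,c,d\in\mathbb{R}$, $ad-bc<0$ and $0\le\beta<\pi$. Let $\omega$ be its characteristic function, let $y_0$ be the eigenfunction, let $y_1=\tilde y_1+Cy_0$ be the first associated function with constant $C$, and let $y_1^{\#}=y_1+C_2y_0$, where $C_2$ is the specific constant defined in the context. Then $$\mathfrak{A}(y_1^{\#})=0\quad\text{if and only if}\quad C=-\frac{\omega^{IV}(\lambda_0)}{4\,\omega'''(\lambda_0)}.$$
   Context: Setting. Let $q$ be a real-valued continuous function on $[0,1]$, let $a,b,c,d$ be reals with $ad-bc<0$, and let $0\le\beta<\pi$. Consider the problem $$-y''+q(x)y=\lambda y\ (0<x<1),\qquad y(0)\cos\beta=y'(0)\sin\beta,\qquad (a\lambda+b)y(1)=(c\lambda+d)y'(1).$$ Let $y(x,\lambda)$ be the solution of $-y''+q(x)y=\lambda y$ with initial data $y(0,\lambda)=\sin\beta$, $y'(0,\lambda)=\cos\beta$ (a prime on $y$-functions denotes $d/dx$). The characteristic function is $$\omega(\lambda)=(a\lambda+b)\,y(1,\lambda)-(c\lambda+d)\,y'(1,\lambda),$$ whose derivatives $\omega',\omega'',\omega''',\omega^{IV},\dots$ are taken with respect to $\lambda$. Eigenvalues are the zeros of $\omega$, with multiplicity the order of the zero; $\lambda_0$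 is a triple eigenvalue if $\omega(\lambda_0)=\omega'(\lambda_0)=\omega''(\lambda_0)=0\ne\omega'''(\lambda_0)$. Root functions. $y_0(x)=y(x,\lambda_0)$ is the eigenfunction; $\tilde y_1(x)=\frac{\partial y}{\partial\lambda}(x,\lambda_0)$; and $y_1=\tilde y_1+Cy_0$, with $C$ a constant, is the first associated function (it satisfies $-y_1''+qy_1=\lambda_0y_1+y_0$, $y_1(0)\cos\beta=y_1'(0)\sin\beta$, $(a\lambda_0+b)y_1(1)+ay_0(1)=(c\lambda_0+d)y_1'(1)+cy_0'(1)$). With the same constant $C$ put $\hat y_1=y_1+Cy_0$. The quantities $\mathfrak{A}$. Define $$\mathfrak{A}(y_0)=\begin{cases}\dfrac{y_0(1)}{c\lambda_0+d}, & c\lambda_0+d\neq0,\\[8pt] \dfrac{y_0'(1)}{a\lambda_0+b}, & c\lambda_0+d=0,\end{cases}$$ and, for $u$ equal to any of $y_1,\hat y_1,y_1^{\#}$, $$\mathfrak{A}(u)=\begin{cases}\dfrac{u(1)}{c\lambda_0+d}-\dfrac{c\,y_0(1)}{(c\lambda_0+d)^2}, & c\lambda_0+d\neq0,\\[8pt] \dfrac{u'(1)}{a\lambda_0+b}-\dfrac{a\,y_0'(1)}{(a\lambda_0+b)^2}, & c\lambda_0+d=0.\end{cases}$$ The function $y_1^{\#}$. $y_1^{\#}=y_1+C_2y_0$, where $$C_2=-\frac{\mathfrak{A}(\hat y_1)\,\frac{\omega'''(\lambda_0)}{6}+\mathfrak{A}(y_0)\,\frac{\omega^{IV}(\lambda_0)}{24}}{\mathfrak{A}(y_0)\,\frac{\omega'''(\lambda_0)}{6}}.$$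 *)

(* Defs.v *)
From Stdlib Require Import Reals.
From Coquelicot Require Import Coquelicot.

(* The spectral parameter, and the solutions, are complex valued; the problem
   data q, a, b, c, d, beta are real and enter through the coercion RtoC.
   Derivatives in the spectral parameter are complex ones (C_derive). *)

Definition I01 (x : R) : Prop := (0 <= x <= 1)%R.

(* Derivative relative to [0,1]: two-sided inside, one-sided at 0 and 1.
   Values of [f] outside [0,1] are irrelevant. *)
Definition is_deriv01 (f : R -> C) (x : R) (l : C) : Prop :=
  @filterdiff R_AbsRing R_NormedModule C_R_NormedModule
    f (within I01 (locally x)) (fun h : R => @scal R_AbsRing C_R_NormedModule h l).

Definition ex_deriv01 (f : R -> C) (x : R) : Prop :=
  exists l : C, is_deriv01 f x l.

Definition deriv01 (f : R -> C) (x : R) : C :=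
  @iota C_CompleteNormedModule (is_deriv01 f x).

Local Open Scope C_scope.

Definition is_solution (q : R -> R) (lam : C) (u : R -> C) : Prop :=
  (forall x : R, I01 x -> ex_deriv01 u x /\ ex_deriv01 (deriv01 u) x) /\
  (forall x : R, (0 < x < 1)%R ->
     - deriv01 (deriv01 u) x + q x * u x = lam * u x).

(* [y x lam] is the solution y(x, lam) normalised at 0. *)
Definition is_initial_solution (q : R -> R) (beta : R) (y : R -> C -> C) : Prop :=
  forall lam : C,
    is_solution q lam (fun x => y x lam) /\
    y 0%R lam = sin beta /\
    deriv01 (fun x => y x lam) 0 = cos beta.

Definition omega (a b c d : R) (y : R -> C -> C) (lam : C) : C :=
  (a * lam + b) * y 1%R lam - (c * lam + d) * deriv01 (fun x => y x lam) 1.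

Definition C_derive_n (f : C -> C) (n : nat) : C -> C := Nat.iter n C_derive f.

Definition triple_zero (w : C -> C) (lam0 : C) : Prop :=
  w lam0 = 0 /\ C_derive_n w 1 lam0 = 0 /\ C_derive_n w 2 lam0 = 0 /\
  C_derive_n w 3 lam0 <> 0.

Definition triple_eigenvalue (a b c d : R) (y : R -> C -> C) (lam0 : C) : Prop :=
  triple_zero (omega a b c d y) lam0.

Definition y_0 (y : R -> C -> C) (lam0 : C) (x : R) : C := y x lam0.

Definition y_1tilde (y : R -> C -> C) (lam0 : C) (x : R) : C :=
  C_derive (fun lam => y x lam) lam0.

(* [K] is the constant C of y_1 = y_1tilde + C y_0; [C] names the complex type. *)
Definition y_1 (y : R -> C -> C) (lam0 K : C) (x : R) : C :=
  y_1tilde y lam0 x + K * y_0 y lam0 x.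

Definition y_1hat (y : R -> C -> C) (lam0 K : C) (x : R) : C :=
  y_1 y lam0 K x + K * y_0 y lam0 x.

(* The Fraktur A of the eigenfunction; [frakA1] below is the Fraktur A of an
   associated function [u], which also involves the eigenfunction [y0]. *)
Definition frakA0 (a b c d : R) (lam0 : C) (y0 : R -> C) : C :=
  if Ceq_dec (c * lam0 + d) 0
  then deriv01 y0 1 / (a * lam0 + b)
  else y0 1%R / (c * lam0 + d).

Definition frakA1 (a b c d : R) (lam0 : C) (y0 u : R -> C) : C :=
  if Ceq_dec (c * lam0 + d) 0
  then deriv01 u 1 / (a * lam0 + b) - a * deriv01 y0 1 / (a * lam0 + b) ^ 2
  else u 1%R / (c * lam0 + d) - c * y0 1%R / (c * lam0 + d) ^ 2.

Definition C_2 (a b c d : R) (y : R -> C -> C) (lam0 K : C) : C :=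
  let w3 := C_derive_n (omega a b c d y) 3 lam0 in
  let w4 := C_derive_n (omega a b c d y) 4 lam0 in
  let A0 := frakA0 a b c d lam0 (y_0 y lam0) in
  let Ahat := frakA1 a b c d lam0 (y_0 y lam0) (y_1hat y lam0 K) in
  - ((Ahat * (w3 / 6) + A0 * (w4 / 24)) / (A0 * (w3 / 6))).

Definition y_1sharp (a b c d : R) (y : R -> C -> C) (lam0 K : C) (x : R) : C :=
  y_1 y lam0 K x + C_2 a b c d y lam0 K * y_0 y lam0 x.

(* Main.v *)
(* The functional A is affine: adding l y_0 to an associated function changes A by l A(y_0), so
   C_2 gives A(y_1#) = - A(y_0) (C + w4 / (4 w3)), where w3 and w4 are the third and fourth
   derivatives of omega at lam0, and everything rests on two facts.
   First, A(y_0) <> 0: otherwise omega(lam0) = 0 forces y_0(1) = y_0'(1) = 0, hence y_0 = 0 by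
   uniqueness for the backward Cauchy problem.
   Second, when c lam0 + d = 0, additivity of A uses the one-sided derivative of y_1tilde at 1,
   so y_1tilde = dy/dlam must be shown to be differentiable in x.  The difference quotients in
   lam solve a linear second-order equation with zero Cauchy data; Gronwall's inequality makes
   them Lipschitz in lam in the C^1 norm and bounds their second derivatives. *)

Require Import Defs.
From Stdlib Require Import Reals Lra FunctionalExtensionality.
From Coquelicot Require Import Coquelicot.

Local Open Scope R_scope.

(** * Real functions on [0,1] *)

(* Retraction onto [0,1], turning continuity relative to [0,1] into continuity on R. *)
Definition clamp (x : R) : R := Rmax 0 (Rmin x 1).

Lemma clamp_I01 x : I01 (clamp x).
Proof. unfold clamp, I01, Rmax, Rmin. repeat destruct Rle_dec; lra. Qed.

Lemma clamp_id x : I01 x -> clamp x = x.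
Proof. unfold clamp, I01, Rmax, Rmin. repeat destruct Rle_dec; lra. Qed.

Lemma clamp_lip x z : Rabs (clamp z - clamp x) <= Rabs (z - x).
Proof.
  unfold clamp, Rmax, Rmin, Rabs. repeat destruct Rle_dec; repeat destruct Rcase_abs; lra.
Qed.

Definition rcontinuous (g : R -> R) : Prop :=
  forall x, continuity_pt (fun t => g (clamp t)) x.

Lemma rcontinuous_intro (g : R -> R) :
  (forall x, I01 x -> forall eps, 0 < eps -> exists delta, 0 < delta /\
     forall z, I01 z -> Rabs (z - x) < delta -> Rabs (g z - g x) < eps) ->
  rcontinuous g.
Proof.
  intros H x eps He.
  destruct (H (clamp x) (clamp_I01 x) eps He) as [delta [Hd H1]].
  exists delta; split; [exact Hd|]. intros z [_ Hz].
  apply H1; [apply clamp_I01|].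
  eapply Rle_lt_trans; [apply clamp_lip|exact Hz].
Qed.

Lemma rcontinuous_plus f g :
  rcontinuous f -> rcontinuous g -> rcontinuous (fun x => f x + g x).
Proof.
  intros Hf Hg x.
  apply (continuity_pt_plus (fun t => f (clamp t)) (fun t => g (clamp t))); auto.
Qed.

Lemma rcontinuous_mult f g :
  rcontinuous f -> rcontinuous g -> rcontinuous (fun x => f x * g x).
Proof.
  intros Hf Hg x.
  apply (continuity_pt_mult (fun t => f (clamp t)) (fun t => g (clamp t))); auto.
Qed.

Lemma rcontinuous_continuity f : continuity f -> rcontinuous f.
Proof.
  intros Hf. apply rcontinuous_intro. intros x _ eps He.
  destruct (Hf x eps He) as [delta [Hd H]].
  exists delta; split; [exact Hd|]. intros z _ Hz.
  destruct (Req_dec z x) as [->|Hzx].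
  - rewrite Rminus_diag, Rabs_R0; exact He.
  - apply (H z). repeat split; auto.
Qed.

Lemma rcontinuous_bounded g : rcontinuous g ->
  exists M, forall x, I01 x -> Rabs (g x) <= M.
Proof.
  intros Hg.
  destruct (continuity_ab_maj (fun t => Rabs (g (clamp t))) 0 1) as [m [Hm _]].
  - lra.
  - intros c _. apply (continuity_pt_comp (fun t => g (clamp t)) Rabs).
    + apply Hg.
    + apply Rcontinuity_abs.
  - exists (Rabs (g (clamp m))). intros x Hx.
    rewrite <- (clamp_id x Hx). apply Hm. exact Hx.
Qed.

(* [k = 0] allows for a mean value point at an end of [0,1], where [dg] is arbitrary. *)
Lemma mean_value01 (g dg : R -> R) x1 x2 :
  rcontinuous g -> (forall x, 0 < x < 1 -> is_derive g x (dg x)) ->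
  I01 x1 -> I01 x2 -> x1 <= x2 ->
  exists k, g x2 - g x1 = k * (x2 - x1) /\
    (k = 0 \/ exists x, 0 < x < 1 /\ x1 <= x <= x2 /\ k = dg x).
Proof.
  intros Hg Hd H1 H2 H12.
  (* The derivative handed to [MVT_gen] is set to 0 outside the open interval, so a mean value point
     at an end yields [k = 0]. *)
  set (inside := fun x => if Rlt_dec 0 x then if Rlt_dec x 1 then true else false else false).
  destruct (MVT_gen (fun t => g (clamp t)) x1 x2 (fun x => if inside x then dg x else 0))
    as [x [Hx Heq]].
  - rewrite Rmin_left, Rmax_right by assumption. intros x Hx.
    assert (H : 0 < x < 1) by (unfold I01 in *; lra).
    unfold inside. destruct Rlt_dec; [|lra]. destruct Rlt_dec; [|lra].
    apply is_derive_ext_loc with (2 := Hd x H).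
    assert (He : 0 < Rmin x (1 - x)) by (apply Rmin_glb_lt; lra).
    exists (mkposreal _ He). intros t Ht. rewrite clamp_id; [reflexivity|].
    change (Rabs (t - x) < Rmin x (1 - x)) in Ht. unfold I01.
    generalize (Rmin_l x (1 - x)) (Rmin_r x (1 - x)) (Rabs_def2 _ _ Ht). lra.
  - intros x _; apply Hg.
  - rewrite Rmin_left, Rmax_right in Hx by assumption.
    rewrite !clamp_id in Heq by assumption.
    eexists; split; [exact Heq|].
    unfold inside in *. destruct (Rlt_dec 0 x); [|tauto]. destruct (Rlt_dec x 1); [|tauto].
    right; exists x; auto.
Qed.

(** * Complex-valued functions differentiable relative to [0,1] *)

(** Epsilon-delta form of [is_deriv01]; the weak inequality without division makes [z = x]
    harmless. *)
Definition cderiv (u : R -> C) (x : R) (l : C) : Prop :=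
  forall eps, 0 < eps -> exists delta, 0 < delta /\
    forall z, I01 z -> Rabs (z - x) < delta ->
      Cmod (u z - u x - RtoC (z - x) * l)%C <= eps * Rabs (z - x).

Lemma norm_C_R (z : C) : @norm R_AbsRing C_R_NormedModule z = Cmod z.
Proof.
  unfold Cmod.
  change (sqrt (Rabs (fst z) ^ 2 + Rabs (snd z) ^ 2) = sqrt (fst z ^ 2 + snd z ^ 2)).
  now rewrite !pow2_abs.
Qed.

Lemma within_I01_proper x : I01 x -> ProperFilter (within I01 (locally x)).
Proof.
  intros Hx. split; [|apply within_filter; apply locally_filter].
  intros P HP. exists x. destruct HP as [d Hd]. apply Hd; [apply ball_center|exact Hx].
Qed.

Lemma is_filter_lim_within_I01 x : is_filter_lim (within I01 (locally x)) x.
Proof. intros P [d Hd]. exists d. intros t Ht _. now apply Hd. Qed.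

Lemma scal_C_R (h : R) (z : C) : @scal R_AbsRing C_R_NormedModule h z = (RtoC h * z)%C.
Proof. apply (scal_R_Cmult h z). Qed.

Lemma is_deriv01_cderiv u x l : I01 x -> (is_deriv01 u x l <-> cderiv u x l).
Proof.
  intros Hx. split.
  - intros [_ H] eps He.
    destruct (H x (is_filter_lim_within_I01 x) (mkposreal eps He)) as [d Hd].
    exists d; split; [apply cond_pos|]. intros z Hz Hzx.
    specialize (Hd z Hzx Hz). rewrite norm_C_R, scal_C_R in Hd. exact Hd.
  - intros H. split; [apply (@is_linear_scal_l R_AbsRing C_R_NormedModule)|].
    intros x' Hx'.
    (* [filterdiff] quantifies over all limits of the filter; properness leaves only [x]. *)
    assert (E : x' = x).
    { apply (@is_filter_lim_unique R_AbsRing R_NormedModule (within I01 (locally x)));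
       [apply Proper_StrongProper, within_I01_proper, Hx|exact Hx'|apply is_filter_lim_within_I01]. }
    subst x'. intros eps.
    destruct (H eps (cond_pos eps)) as [d [Hd Hz]].
    exists (mkposreal d Hd). intros z Hzx Iz. rewrite norm_C_R, scal_C_R. exact (Hz z Iz Hzx).
Qed.

(** Subtracting the two expansions bounds [(l1 - l2) * (z - x)] by [eps * |z - x|]; it remains to
    find a point [z <> x] of [0,1] near [x]. *)
Lemma cderiv_unique u x l1 l2 : I01 x -> cderiv u x l1 -> cderiv u x l2 -> l1 = l2.
Proof.
  intros Hx H1 H2.
  assert (H : Cmod (l1 - l2) <= 0).
  { apply le_epsilon. intros eps He. rewrite Rplus_0_l.
    destruct (H1 (eps / 2) ltac:(lra)) as [d1 [Hd1 B1]].
    destruct (H2 (eps / 2) ltac:(lra)) as [d2 [Hd2 B2]].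
    assert (exists z, I01 z /\ z <> x /\ Rabs (z - x) < Rmin d1 d2) as [z [Iz [Hzx Hz]]].
    (* Since [m <= 1/4], a step to the right stays in [0,1] when [x <= 1/2], and a step to the left
       does otherwise. *)
    { set (m := Rmin (Rmin d1 d2) (1 / 2) / 2).
      assert (Hm : 0 < m < Rmin d1 d2 /\ m <= 1 / 4).
      { generalize (Rmin_glb_lt d1 d2 0 Hd1 Hd2) (Rmin_l (Rmin d1 d2) (1/2))
          (Rmin_r (Rmin d1 d2) (1/2))
          (Rmin_glb_lt (Rmin d1 d2) (1 / 2) 0 (Rmin_glb_lt d1 d2 0 Hd1 Hd2) ltac:(lra)).
        unfold m. lra. }
      unfold I01 in *. destruct (Rle_dec x (1 / 2)).
      - exists (x + m). replace (x + m - x) with m by ring. rewrite Rabs_right by lra. lra.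
      - exists (x - m). replace (x - m - x) with (- m) by ring.
        rewrite Rabs_Ropp, Rabs_right by lra. lra. }
    specialize (B1 z Iz (Rlt_le_trans _ _ _ Hz (Rmin_l _ _))).
    specialize (B2 z Iz (Rlt_le_trans _ _ _ Hz (Rmin_r _ _))).
    assert (Hp : 0 < Rabs (z - x)) by (apply Rabs_pos_lt; lra).
    apply Rmult_le_reg_r with (Rabs (z - x)); [exact Hp|].
    rewrite <- (Cmod_R (z - x)) at 1. rewrite <- Cmod_mult.
    replace ((l1 - l2) * RtoC (z - x))%C with
      ((u z - u x - RtoC (z - x) * l2) + - (u z - u x - RtoC (z - x) * l1))%C by ring.
    eapply Rle_trans; [apply Cmod_triangle|]. rewrite Cmod_opp. lra. }
  assert (H0 : Cmod (l1 - l2) = 0) by (generalize (Cmod_ge_0 (l1 - l2)); lra).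
  apply Cmod_eq_0 in H0. replace l1 with ((l1 - l2) + l2)%C by ring. rewrite H0. ring.
Qed.

(** [deriv01] is an [iota], so it can be evaluated only because the derivative is unique. *)
Lemma deriv01_unique u x l : I01 x -> cderiv u x l -> deriv01 u x = l.
Proof.
  intros Hx H. unfold deriv01. apply (@iota_unique C_AbsRing C_CompleteNormedModule).
  - intros l' H'. apply cderiv_unique with u x; auto. now apply is_deriv01_cderiv.
  - now apply is_deriv01_cderiv.
Qed.

Lemma ex_deriv01_cderiv u x : I01 x -> ex_deriv01 u x -> cderiv u x (deriv01 u x).
Proof.
  intros Hx [l H]. apply is_deriv01_cderiv in H; [|exact Hx].
  now rewrite (deriv01_unique u x l Hx H).
Qed.

Lemma cderiv_ext u w x l : (forall t, I01 t -> u t = w t) -> I01 x -> cderiv u x l -> cderiv w x l.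
Proof.
  intros E Hx H eps He. destruct (H eps He) as [d [Hd B]]. exists d; split; [exact Hd|].
  intros z Iz Hz. rewrite <- !E by assumption. auto.
Qed.

Lemma cderiv_plus u w x l m :
  cderiv u x l -> cderiv w x m -> cderiv (fun t => u t + w t)%C x (l + m)%C.
Proof.
  intros H1 H2 eps He.
  destruct (H1 (eps / 2) ltac:(lra)) as [d1 [Hd1 B1]].
  destruct (H2 (eps / 2) ltac:(lra)) as [d2 [Hd2 B2]].
  exists (Rmin d1 d2); split; [now apply Rmin_glb_lt|]. intros z Iz Hz.
  specialize (B1 z Iz (Rlt_le_trans _ _ _ Hz (Rmin_l _ _))).
  specialize (B2 z Iz (Rlt_le_trans _ _ _ Hz (Rmin_r _ _))).
  replace (u z + w z - (u x + w x) - RtoC (z - x) * (l + m))%C with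
    ((u z - u x - RtoC (z - x) * l) + (w z - w x - RtoC (z - x) * m))%C by ring.
  eapply Rle_trans; [apply Cmod_triangle|]. lra.
Qed.

Lemma cderiv_scal (k : C) u x l :
  cderiv u x l -> cderiv (fun t => k * u t)%C x (k * l)%C.
Proof.
  intros H eps He.
  (* The summand 1 covers the case [k = 0]. *)
  assert (Hk : 0 < Cmod k + 1) by (generalize (Cmod_ge_0 k); lra).
  destruct (H (eps / (Cmod k + 1)) (Rdiv_lt_0_compat _ _ He Hk)) as [d [Hd B]].
  exists d; split; [exact Hd|]. intros z Iz Hz. specialize (B z Iz Hz).
  replace (k * u z - k * u x - RtoC (z - x) * (k * l))%C with
    (k * (u z - u x - RtoC (z - x) * l))%C by ring.
  rewrite Cmod_mult.
  replace (eps * Rabs (z - x)) with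
    ((Cmod k + 1) * (eps / (Cmod k + 1) * Rabs (z - x))) by (field; lra).
  apply Rmult_le_compat; auto using Cmod_ge_0. lra.
Qed.

Lemma cderiv_reflect u x l :
  I01 x -> cderiv u (1 - x) l -> cderiv (fun t => u (1 - t)) x (- l)%C.
Proof.
  intros Hx H eps He. destruct (H eps He) as [d [Hd B]]. exists d; split; [exact Hd|].
  intros z Iz Hz.
  assert (E : (1 - z) - (1 - x) = - (z - x)) by ring.
  specialize (B (1 - z)). rewrite E, Rabs_Ropp in B.
  replace (RtoC (z - x) * - l)%C with (RtoC (- (z - x)) * l)%C
    by (rewrite RtoC_opp; ring).
  apply B; [unfold I01 in *; lra|exact Hz].
Qed.

Lemma cderiv_linear (k : C) x : cderiv (fun t => RtoC t * k)%C x k.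
Proof.
  intros eps He. exists 1; split; [lra|]. intros z _ _.
  replace (RtoC z * k - RtoC x * k - RtoC (z - x) * k)%C with (RtoC 0).
  - rewrite Cmod_0. generalize (Rabs_pos (z - x)). nra.
  - rewrite RtoC_minus. ring.
Qed.

(** * Mean value estimates through real and imaginary parts *)

Lemma im_le_Cmod (z : C) : Rabs (Im z) <= Cmod z.
Proof. eapply Rle_trans; [apply Rmax_r|apply Rmax_Cmod]. Qed.

Lemma cderiv_continuous u x l : cderiv u x l ->
  forall eps, 0 < eps -> exists delta, 0 < delta /\
    forall z, I01 z -> Rabs (z - x) < delta -> Cmod (u z - u x) < eps.
Proof.
  intros H eps He. destruct (H 1 Rlt_0_1) as [d [Hd B]].
  assert (Hl : 0 < Cmod l + 1) by (generalize (Cmod_ge_0 l); lra).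
  exists (Rmin d (eps / (Cmod l + 1))); split.
  - apply Rmin_glb_lt; [exact Hd|now apply Rdiv_lt_0_compat].
  - intros z Iz Hz.
    specialize (B z Iz (Rlt_le_trans _ _ _ Hz (Rmin_l _ _))).
    apply Rlt_le_trans with (2 := Rmin_r _ _) in Hz.
    replace (u z - u x)%C with ((u z - u x - RtoC (z - x) * l) + RtoC (z - x) * l)%C by ring.
    eapply Rle_lt_trans; [apply Cmod_triangle|].
    rewrite Cmod_mult, Cmod_R.
    apply Rmult_lt_compat_r with (r := Cmod l + 1) in Hz; [|exact Hl].
    replace (eps / (Cmod l + 1) * (Cmod l + 1)) with eps in Hz by (field; lra). lra.
Qed.

(** The mean value theorem needs real values; this captures what [Re] and [Im] share, so that each
    argument is made once. *)
Definition component (p : C -> R) : Prop :=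
  (forall z w, p (z - w)%C = p z - p w) /\
  (forall (r : R) z, p (RtoC r * z)%C = r * p z) /\
  (forall z, Rabs (p z) <= Cmod z).

Lemma component_Re : component Re.
Proof.
  split; [reflexivity|split; [|exact re_le_Cmod]]. intros r z. unfold Re; simpl; ring.
Qed.

Lemma component_Im : component Im.
Proof.
  split; [reflexivity|split; [|exact im_le_Cmod]]. intros r z. unfold Im; simpl; ring.
Qed.

Lemma cderiv_rcontinuous_component p u : component p ->
  (forall x, I01 x -> exists l, cderiv u x l) -> rcontinuous (fun t => p (u t)).
Proof.
  intros [p_minus [_ p_le]] H. apply rcontinuous_intro. intros x Hx eps He.
  destruct (H x Hx) as [l Hl].
  destruct (cderiv_continuous u x l Hl eps He) as [d [Hd B]].
  exists d; split; [exact Hd|]. intros z Iz Hz. rewrite <- p_minus.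
  eapply Rle_lt_trans; [apply p_le|auto].
Qed.

Lemma cderiv_is_derive_component p u x l : component p ->
  0 < x < 1 -> cderiv u x l -> is_derive (fun t => p (u t)) x (p l).
Proof.
  intros [p_minus [p_real p_le]] Hx H. apply is_derive_Reals. intros eps He.
  destruct (H (eps / 2) ltac:(lra)) as [d [Hd B]].
  assert (Hm : 0 < Rmin d (Rmin x (1 - x))) by (repeat apply Rmin_glb_lt; lra).
  exists (mkposreal _ Hm). simpl. intros h Hh0 Hh.
  assert (Hh1 := Rlt_le_trans _ _ _ Hh (Rmin_l _ _)).
  assert (Hh2 := Rlt_le_trans _ _ _ Hh (Rmin_r _ _)).
  assert (Ih : I01 (x + h)).
  { generalize (Rmin_l x (1 - x)) (Rmin_r x (1 - x)) (Rabs_def2 _ _ Hh2). unfold I01. lra. }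
  specialize (B (x + h) Ih). replace (x + h - x) with h in B by ring. specialize (B Hh1).
  assert (Hp : 0 < Rabs h) by now apply Rabs_pos_lt.
  apply Rmult_lt_reg_r with (Rabs h); [exact Hp|]. rewrite <- Rabs_mult.
  replace (((p (u (x + h)) - p (u x)) / h - p l) * h)
    with (p (u (x + h)%R - u x - RtoC h * l)%C)
    by (rewrite !p_minus, p_real; field; exact Hh0).
  eapply Rle_lt_trans; [apply p_le|]. eapply Rle_lt_trans; [exact B|]. nra.
Qed.

(** Mean value theorem for one component; [0 <= B] settles the alternative [k = 0]. *)
Lemma component_lipschitz p u v B x1 x2 : component p ->
  (forall x, I01 x -> exists l, cderiv u x l) -> (forall x, 0 < x < 1 -> cderiv u x (v x)) ->
  I01 x1 -> I01 x2 -> x1 <= x2 -> 0 <= B ->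
  (forall x, 0 < x < 1 -> x1 <= x <= x2 -> Cmod (v x) <= B) ->
  Rabs (p (u x2) - p (u x1)) <= B * (x2 - x1).
Proof.
  intros Hp H H' I1 I2 H12 B0 HB.
  destruct (mean_value01 (fun t => p (u t)) (fun t => p (v t)) x1 x2) as [k [Ek Hk]]; auto.
  - apply cderiv_rcontinuous_component; eauto.
  - intros x Hx. apply cderiv_is_derive_component; auto.
  - rewrite Ek, Rabs_mult, (Rabs_right (x2 - x1)) by lra.
    apply Rmult_le_compat_r; [lra|].
    destruct Hk as [->|[x [Ix [Hx ->]]]].
    + now rewrite Rabs_R0.
    + eapply Rle_trans; [apply (proj2 (proj2 Hp))|auto].
Qed.

Lemma Cmod_le_components (z : C) : Cmod z <= Rabs (Re z) + Rabs (Im z).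
Proof.
  replace z with (RtoC (Re z) + Ci * RtoC (Im z))%C at 1
    by (destruct z; apply injective_projections; simpl; ring).
  eapply Rle_trans; [apply Cmod_triangle|]. rewrite Cmod_mult, Cmod_Ci, !Cmod_R. lra.
Qed.

(** The factor 2 comes from adding the bounds for the two components. Measuring distance from [x1]
    treats both orders of [x1] and [x2] at once. *)
Lemma cderiv_lipschitz u v B x1 x2 :
  (forall x, I01 x -> exists l, cderiv u x l) -> (forall x, 0 < x < 1 -> cderiv u x (v x)) ->
  I01 x1 -> I01 x2 -> 0 <= B ->
  (forall x, 0 < x < 1 -> Rabs (x - x1) <= Rabs (x2 - x1) -> Cmod (v x) <= B) ->
  Cmod (u x2 - u x1)%C <= 2 * B * Rabs (x2 - x1).
Proof.
  intros H H' I1 I2 B0 HB. eapply Rle_trans; [apply Cmod_le_components|].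
  rewrite (proj1 component_Re), (proj1 component_Im).
  destruct (Rle_dec x1 x2) as [Hx|Hx].
  - assert (HB' : forall x, 0 < x < 1 -> x1 <= x <= x2 -> Cmod (v x) <= B).
    { intros x I Hxx. apply HB; [exact I|]. rewrite !Rabs_right; lra. }
    rewrite (Rabs_right (x2 - x1)) by lra.
    generalize (component_lipschitz Re u v B x1 x2 component_Re H H' I1 I2 Hx B0 HB')
      (component_lipschitz Im u v B x1 x2 component_Im H H' I1 I2 Hx B0 HB'). lra.
  - assert (HB' : forall x, 0 < x < 1 -> x2 <= x <= x1 -> Cmod (v x) <= B).
    { intros x I Hxx. apply HB; [exact I|]. rewrite !Rabs_left1; lra. }
    rewrite (Rabs_minus_sym x2 x1), (Rabs_right (x1 - x2)) by lra.
    rewrite Rabs_minus_sym, (Rabs_minus_sym (Im _)).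
    generalize (component_lipschitz Re u v B x2 x1 component_Re H H' I2 I1 ltac:(lra) B0 HB')
      (component_lipschitz Im u v B x2 x1 component_Im H H' I2 I1 ltac:(lra) B0 HB'). lra.
Qed.

(* [u' = v] up to the endpoints, but [v' = w] only in the open interval. *)
Definition second_order (u v w : R -> C) : Prop :=
  (forall x, I01 x -> cderiv u x (v x)) /\
  (forall x, I01 x -> exists l, cderiv v x l) /\
  (forall x, 0 < x < 1 -> cderiv v x (w x)).

Lemma second_order_lincomb (k1 k2 : C) u1 v1 w1 u2 v2 w2 :
  second_order u1 v1 w1 -> second_order u2 v2 w2 ->
  second_order (fun x => k1 * u1 x + k2 * u2 x)%C (fun x => k1 * v1 x + k2 * v2 x)%C
    (fun x => k1 * w1 x + k2 * w2 x)%C.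
Proof.
  intros [A1 [B1 C1]] [A2 [B2 C2]]. split; [|split].
  - intros x Hx. apply cderiv_plus; apply cderiv_scal; auto.
  - intros x Hx. destruct (B1 x Hx) as [l1 H1]. destruct (B2 x Hx) as [l2 H2].
    eexists. apply cderiv_plus; apply cderiv_scal; eassumption.
  - intros x Hx. apply cderiv_plus; apply cderiv_scal; auto.
Qed.

(** Moves Cauchy data from 1 to 0; the first derivative changes sign and the second does not. *)
Lemma second_order_reflect u v w : second_order u v w ->
  second_order (fun x => u (1 - x)) (fun x => - v (1 - x)%R)%C (fun x => w (1 - x)).
Proof.
  assert (R : forall x, I01 x -> I01 (1 - x)) by (unfold I01; intros; lra).
  assert (N : forall f x l, I01 x -> cderiv f (1 - x) l -> cderiv (fun t => - f (1 - t)%R)%C x l).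
  { intros f x l Hx Hl. replace l with (RtoC (-1) * - l)%C
      by (apply injective_projections; simpl; ring).
    apply cderiv_ext with (fun t => RtoC (-1) * f (1 - t)%R)%C;
      [intros; apply injective_projections; simpl; ring|exact Hx|].
    apply cderiv_scal. now apply cderiv_reflect. }
  intros [A [B C]]. split; [|split].
  - intros x Hx. apply cderiv_reflect; auto.
  - intros x Hx. destruct (B (1 - x) (R x Hx)) as [l Hl]. exists l. auto.
  - intros x Hx. apply N; [unfold I01; lra|]. apply C; lra.
Qed.

(** Two Lipschitz estimates: [v - v x0] is at most [2 * B * |t - x0|], and it is the derivative of
    [u] minus the linear function [t * v x0]. *)
Lemma second_order_taylor u v w B x0 x :
  second_order u v w -> I01 x0 -> I01 x -> 0 <= B ->
  (forall t, 0 < t < 1 -> Cmod (w t) <= B) ->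
  Cmod (u x - u x0 - RtoC (x - x0) * v x0)%C <= 4 * B * (x - x0) ^ 2.
Proof.
  intros [Hu [Hv Hw]] I0 Ix B0 HB.
  assert (HD : forall t, I01 t ->
    cderiv (fun t => u t + (RtoC (-1)) * (RtoC t * v x0))%C t (v t + RtoC (-1) * v x0)%C).
  { intros t Ht. apply cderiv_plus; [auto|]. apply cderiv_scal, cderiv_linear. }
  replace (u x - u x0 - RtoC (x - x0) * v x0)%C with
    ((u x + RtoC (-1) * (RtoC x * v x0)) - (u x0 + RtoC (-1) * (RtoC x0 * v x0)))%C
    by (apply injective_projections; simpl; ring).
  rewrite <- (pow2_abs (x - x0)).
  replace (4 * B * Rabs (x - x0) ^ 2) with (2 * (2 * B * Rabs (x - x0)) * Rabs (x - x0)) by ring.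
  assert (0 <= B * Rabs (x - x0)) by (apply Rmult_le_pos; [exact B0|apply Rabs_pos]).
  apply cderiv_lipschitz with
    (u := fun t => (u t + RtoC (-1) * (RtoC t * v x0))%C)
    (v := fun t => (v t + RtoC (-1) * v x0)%C); auto.
  - eauto.
  - intros t Ht. apply HD. unfold I01; lra.
  - lra.
  - intros t Ht Htx.
    replace (v t + RtoC (-1) * v x0)%C with (v t - v x0)%C
      by (apply injective_projections; simpl; ring).
    apply Rle_trans with (2 * B * Rabs (t - x0)); [|apply Rmult_le_compat_l; lra].
    apply cderiv_lipschitz with w; auto. unfold I01; lra.
Qed.

(** * Gronwall estimates *)

(** Cauchy-Schwarz in the plane, read off from the real part of [Cconj z * w]. *)
Lemma dot_le_Cmod (z w : C) : Re z * Re w + Im z * Im w <= Cmod z * Cmod w.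
Proof.
  rewrite <- (Cmod_conj z), <- Cmod_mult.
  replace (Re z * Re w + Im z * Im w) with (Re (Cconj z * w)%C)
    by (unfold Re, Im; simpl; ring).
  eapply Rle_trans; [apply Rle_abs|apply re_le_Cmod].
Qed.

(** The functions [f1] to [f4] stand for the real and imaginary parts of [u] and [v] in the Gronwall
    energy, and [k] for [- eps^2]. *)
Lemma is_derive_weighted_squares (L k x : R) (f1 f2 f3 f4 : R -> R) (d1 d2 d3 d4 : R) :
  is_derive f1 x d1 -> is_derive f2 x d2 -> is_derive f3 x d3 -> is_derive f4 x d4 ->
  is_derive
    (fun t => exp (- L * t) * (f1 t * f1 t + f2 t * f2 t + (f3 t * f3 t + f4 t * f4 t)) + k * t) x
    (exp (- L * x) * (2 * (f1 x * d1 + f2 x * d2) + 2 * (f3 x * d3 + f4 x * d4)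
       - L * (f1 x * f1 x + f2 x * f2 x + (f3 x * f3 x + f4 x * f4 x))) + k).
Proof.
  intros D1 D2 D3 D4. auto_derive.
  - repeat split; eexists; eassumption.
  - rewrite (is_derive_unique (fun t : R => f1 t) _ _ D1), (is_derive_unique (fun t : R => f2 t) _ _ D2),
      (is_derive_unique (fun t : R => f3 t) _ _ D3), (is_derive_unique (fun t : R => f4 t) _ _ D4). ring.
Qed.

(* The function [x |-> exp (- L x) (|u|^2 + |v|^2) - eps^2 x], with [L = M + 2], is nonincreasing. *)
Lemma gronwall (u v w : R -> C) (M eps : R) :
  second_order u v w -> 0 <= M -> 0 <= eps ->
  (forall x, 0 < x < 1 -> Cmod (w x) <= M * Cmod (u x) + eps) ->
  forall x, I01 x ->
    Cmod (u x) ^ 2 + Cmod (v x) ^ 2 <=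
    (Cmod (u 0%R) ^ 2 + Cmod (v 0%R) ^ 2 + eps ^ 2) * exp (M + 2).
Proof.
  intros [Hu [Hv Hw]] HM Heps Hb x Hx.
  set (E := fun t => Re (u t) * Re (u t) + Im (u t) * Im (u t)
                     + (Re (v t) * Re (v t) + Im (v t) * Im (v t))).
  assert (EC : forall t, Cmod (u t) ^ 2 + Cmod (v t) ^ 2 = E t).
  { intro t. rewrite !Cmod2_alt. unfold E. ring. }
  rewrite !EC.
  set (L := M + 2).
  set (G := fun t => exp (- L * t) * E t + - (eps ^ 2) * t).
  assert (CG : rcontinuous G).
  { assert (Hu' : forall x, I01 x -> exists l, cderiv u x l) by eauto.
    generalize (cderiv_rcontinuous_component Re u component_Re Hu')
      (cderiv_rcontinuous_component Im u component_Im Hu')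
      (cderiv_rcontinuous_component Re v component_Re Hv)
      (cderiv_rcontinuous_component Im v component_Im Hv).
    intros C1 C2 C3 C4. unfold G.
    apply (rcontinuous_plus (fun t => exp (- L * t) * E t) (fun t => - (eps ^ 2) * t)).
    - apply (rcontinuous_mult (fun t => exp (- L * t)) E).
      + apply rcontinuous_continuity. intro t.
        apply derivable_continuous_pt, ex_derive_Reals_0. auto_derive. exact I.
      + apply (rcontinuous_plus (fun t => Re (u t) * Re (u t) + Im (u t) * Im (u t))
                 (fun t => Re (v t) * Re (v t) + Im (v t) * Im (v t)));
          [apply (rcontinuous_plus (fun t => Re (u t) * Re (u t)) (fun t => Im (u t) * Im (u t)))
          |apply (rcontinuous_plus (fun t => Re (v t) * Re (v t)) (fun t => Im (v t) * Im (v t)))];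
          apply rcontinuous_mult; assumption.
    - apply rcontinuous_continuity. intro t.
      apply derivable_continuous_pt, ex_derive_Reals_0. auto_derive. exact I. }
  set (dE := fun t => 2 * (Re (u t) * Re (v t) + Im (u t) * Im (v t))
                     + 2 * (Re (v t) * Re (w t) + Im (v t) * Im (w t))).
  assert (DG : forall t, 0 < t < 1 ->
    is_derive G t (exp (- L * t) * (dE t - L * E t) - eps ^ 2)).
  { intros t Ht.
    assert (It : I01 t) by (unfold I01; lra).
    assert (D1 := cderiv_is_derive_component Re u t _ component_Re Ht (Hu t It)).
    assert (D2 := cderiv_is_derive_component Im u t _ component_Im Ht (Hu t It)).
    assert (D3 := cderiv_is_derive_component Re v t _ component_Re Ht (Hw t Ht)).
    assert (D4 := cderiv_is_derive_component Im v t _ component_Im Ht (Hw t Ht)).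
    exact (is_derive_weighted_squares L (- (eps ^ 2)) t _ _ _ _ _ _ _ _ D1 D2 D3 D4). }
  destruct (mean_value01 G _ 0 x CG DG) as [k [Ek Hk]];
    [unfold I01; lra|exact Hx|apply Hx|].
  assert (k <= 0).
  { destruct Hk as [->|[t [Ht [_ ->]]]]; [lra|].
    (* By Cauchy-Schwarz, [dE] is at most [2 cu cv + 2 M cu cv + 2 cv eps]. Bounding each product by
       squares gives [(M + 2) E + eps^2], whence the choice of [L]. *)
    assert (B : dE t - L * E t <= eps ^ 2).
    { unfold dE. rewrite <- EC. unfold L.
      generalize (dot_le_Cmod (u t) (v t)) (dot_le_Cmod (v t) (w t)) (Hb t Ht)
        (Cmod_ge_0 (u t)) (Cmod_ge_0 (v t)).
      generalize (Cmod (w t)). intros cw.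
      set (cu := Cmod (u t)); set (cv := Cmod (v t)). clearbody cu cv. intros A1 A2 A3 A4 A5.
      assert (cv * cw <= cv * (M * cu + eps)) by (apply Rmult_le_compat_l; assumption).
      assert (0 <= M * (cu - cv) ^ 2) by (apply Rmult_le_pos; [exact HM|apply pow2_ge_0]).
      generalize (pow2_ge_0 (cu - cv)) (pow2_ge_0 (cv - eps)) (pow2_ge_0 cu). nra. }
    assert (0 < exp (- L * t) <= 1).
    { split; [apply exp_pos|]. rewrite <- exp_0.
      assert (- L * t <= 0) by (unfold L; nra).
      destruct (Req_dec (- L * t) 0) as [->|]; [lra|left; apply exp_increasing; lra]. }
    generalize (pow2_ge_0 eps). nra. }
  assert (HG : G x <= G 0) by (destruct Hx; nra).
  unfold G in HG. rewrite Rmult_0_r, exp_0 in HG.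
  assert (HE : exp (- L * x) * E x <= E 0 + eps ^ 2).
  { generalize (pow2_ge_0 eps). destruct Hx; nra. }
  (* The weight is undone here; as [x <= 1], this costs a factor of at most [exp L]. *)
  assert (E x = exp (L * x) * (exp (- L * x) * E x)) as ->.
  { rewrite <- Rmult_assoc, <- exp_plus. replace (L * x + - L * x) with 0 by ring.
    rewrite exp_0; ring. }
  rewrite Rmult_comm.
  assert (0 <= E x) by (rewrite <- EC; generalize (pow2_ge_0 (Cmod (u x))) (pow2_ge_0 (Cmod (v x))); lra).
  apply Rmult_le_compat; try (left; apply exp_pos); [|exact HE|].
  - apply Rmult_le_pos; [left; apply exp_pos|assumption].
  - assert (L * x <= L) by (unfold L; destruct Hx; nra).
    destruct (Req_dec (L * x) L) as [->|]; [lra|left; apply exp_increasing; lra].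
Qed.

(** As [exp (M + 2) > 1], it may be replaced by its square in the energy bound; taking roots then
    leaves a bound linear in [eps]. *)
Lemma gronwall_zero (u v w : R -> C) (M eps : R) :
  second_order u v w -> 0 <= M -> 0 <= eps ->
  (forall x, 0 < x < 1 -> Cmod (w x) <= M * Cmod (u x) + eps) ->
  u 0 = RtoC 0 -> v 0 = RtoC 0 ->
  forall x, I01 x ->
    Cmod (u x) <= eps * exp (M + 2) /\ Cmod (v x) <= eps * exp (M + 2).
Proof.
  intros H HM He Hb U0 V0 x Hx.
  assert (G := gronwall u v w M eps H HM He Hb x Hx).
  rewrite U0, V0, Cmod_0 in G.
  assert (1 < exp (M + 2)) by (rewrite <- exp_0; apply exp_increasing; lra).
  assert (0 <= eps * exp (M + 2)) by (apply Rmult_le_pos; lra).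
  assert (Cmod (u x) ^ 2 + Cmod (v x) ^ 2 <= (eps * exp (M + 2)) ^ 2).
  { eapply Rle_trans; [exact G|]. generalize (pow2_ge_0 eps). intro.
    replace ((eps * exp (M + 2)) ^ 2) with (eps ^ 2 * (exp (M + 2) * exp (M + 2))) by ring.
    replace ((0 ^ 2 + 0 ^ 2 + eps ^ 2) * exp (M + 2)) with (eps ^ 2 * exp (M + 2)) by ring.
    apply Rmult_le_compat_l; nra. }
  generalize (pow2_ge_0 (Cmod (u x))) (pow2_ge_0 (Cmod (v x))). intros.
  split; (apply Rsqr_incr_0_var; [unfold Rsqr; lra|assumption]).
Qed.

(** Gronwall with [eps = 0] for the reflected system, evaluated at its right end. *)
Lemma backward_uniqueness (u v w : R -> C) (M : R) :
  second_order u v w -> 0 <= M ->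
  (forall x, 0 < x < 1 -> Cmod (w x) <= M * Cmod (u x)) ->
  u 1 = RtoC 0 -> v 1 = RtoC 0 -> u 0 = RtoC 0 /\ v 0 = RtoC 0.
Proof.
  intros H HM Hb U1 V1.
  destruct (gronwall_zero _ _ _ M 0 (second_order_reflect u v w H) HM (Rle_refl 0)) with (x := 1)
    as [Eu Ev].
  - intros x Hx. rewrite Rplus_0_r. apply Hb. lra.
  - now rewrite Rminus_0_r.
  - rewrite Rminus_0_r, V1. ring.
  - unfold I01; lra.
  - rewrite Rmult_0_l, Rminus_diag in Eu, Ev. rewrite Cmod_opp in Ev.
    split; apply Cmod_eq_0, Rle_antisym; auto using Cmod_ge_0.
Qed.

(** * Differentiation in the spectral parameter *)

(** Balls of the uniform space [C] and discs for [Cmod] agree up to a factor [sqrt 2], absorbed by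
    halving the radius. *)
Lemma locally'_C (z : C) (P : C -> Prop) :
  locally' z P <-> exists d, 0 < d /\ forall x, Cmod (x - z)%C < d -> x <> z -> P x.
Proof.
  split.
  - intros [d Hd]. exists d; split; [apply cond_pos|]. intros x Hx.
    apply Hd. now apply C_NormedModule_mixin_compat1.
  - intros [d [Hd H]]. assert (Hd2 : 0 < d / 2) by lra.
    exists (mkposreal _ Hd2). intros x Hx. apply H.
    apply C_NormedModule_mixin_compat2 in Hx. simpl in Hx.
    assert (sqrt 2 <= 2).
    { rewrite <- (sqrt_square 2) at 2 by lra. apply sqrt_le_1_alt. lra. }
    change (Cmod (x - z)%C < sqrt 2 * (d / 2)) in Hx. nra.
Qed.

Lemma locally'_C_proper (z : C) : ProperFilter (locally' z).
Proof.
  split; [|apply within_filter, locally_filter].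
  intros P H. apply locally'_C in H. destruct H as [d [Hd H]].
  exists (z + RtoC (d / 2))%C.
  assert (E : (z + RtoC (d / 2) - z)%C = RtoC (d / 2)) by ring.
  apply H.
  - rewrite E, Cmod_R, Rabs_right; lra.
  - intro Hz. rewrite Hz in E. assert (RtoC 0 = RtoC (d / 2)) as E' by (rewrite <- E; ring).
    apply RtoC_inj in E'. lra.
Qed.

(** [C_lim] is total, so existence of the limit comes first: the Lipschitz bound gives the Cauchy
    property and completeness applies. The estimate follows by letting [m] tend to [z]. *)
Lemma C_lim_of_lipschitz (f : C -> C) (z : C) (c : R) : 0 <= c ->
  (forall l m, l <> z -> m <> z -> Cmod (l - z)%C <= 1 -> Cmod (m - z)%C <= 1 ->
     Cmod (f l - f m)%C <= c * Cmod (l - m)%C) ->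
  forall l, l <> z -> Cmod (l - z)%C <= 1 ->
    Cmod (f l - C_lim f z)%C <= c * Cmod (l - z)%C.
Proof.
  intros Hc Hf.
  assert (PF := locally'_C_proper z).
  destruct (proj1 (@filterlim_locally_cauchy C
    (CompleteNormedModule.CompleteSpace C_AbsRing C_CompleteNormedModule) (locally' z) PF f))
    as [y Hy].
  { intros eps.
    assert (Hd : 0 < Rmin 1 (eps / (2 * (c + 1)))).
    (* Two points this close to [z] are within [eps / (c + 1)] of each other; the summand 1 allows
       [c = 0]. *)
    { apply Rmin_glb_lt; [lra|]. apply Rdiv_lt_0_compat; [apply cond_pos|lra]. }
    exists (fun x => x <> z /\ Cmod (x - z)%C < Rmin 1 (eps / (2 * (c + 1)))). split.
    - apply locally'_C. eexists; split; [exact Hd|]. auto.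
    - intros u v [Hu Bu] [Hv Bv]. apply C_NormedModule_mixin_compat1.
      assert (Bu1 := Rlt_le_trans _ _ _ Bu (Rmin_l _ _)).
      assert (Bv1 := Rlt_le_trans _ _ _ Bv (Rmin_l _ _)).
      assert (Bu2 := Rlt_le_trans _ _ _ Bu (Rmin_r _ _)).
      assert (Bv2 := Rlt_le_trans _ _ _ Bv (Rmin_r _ _)).
      eapply Rle_lt_trans; [apply (Hf v u); auto; lra|].
      assert (Cmod (v - u)%C < eps / (c + 1)).
      { replace (v - u)%C with ((v - z) + - (u - z))%C by ring.
        eapply Rle_lt_trans; [apply Cmod_triangle|]. rewrite Cmod_opp.
        replace (eps / (c + 1)) with (eps / (2 * (c + 1)) + eps / (2 * (c + 1))) by (field; lra).
        lra. }
      replace (pos eps) with ((c + 1) * (eps / (c + 1))) by (field; lra).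
      generalize (Cmod_ge_0 (v - u)%C). nra. }
  rewrite (is_C_lim_unique f z y Hy).
  intros l Hl Bl. apply le_epsilon. intros eps He.
  assert (Hy' : locally' z (fun x => Cmod (f x - y)%C < eps / 2)).
  { assert (He4 : 0 < eps / 4) by lra.
    assert (Hb : locally' z (fun x => ball y (mkposreal _ He4) (f x)))
      by exact (Hy _ (locally_ball y (mkposreal _ He4))).
    apply filter_imp with (2 := Hb). intros x Hx. apply C_NormedModule_mixin_compat2 in Hx. simpl in Hx.
    assert (sqrt 2 <= 2).
    { rewrite <- (sqrt_square 2) at 2 by lra. apply sqrt_le_1_alt. lra. }
    change (Cmod (f x - y)%C < sqrt 2 * (eps / 4)) in Hx. nra. }
  apply locally'_C in Hy'. destruct Hy' as [d [Hd Hy']].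
  (* The point [m] is taken so near [z] that [|f m - y|] and [c * |m - z|] are each at most
     [eps / 2]. *)
  assert (Hd' : 0 < Rmin 1 (Rmin d (eps / (2 * (c + 1))))).
  { repeat apply Rmin_glb_lt; try lra. apply Rdiv_lt_0_compat; lra. }
  destruct (@filter_ex _ _ PF (fun x => x <> z /\ Cmod (x - z)%C < Rmin 1 (Rmin d (eps / (2 * (c + 1))))))
    as [m [Hm Bm]].
  { apply locally'_C. eexists; split; [exact Hd'|]. auto. }
  assert (Bm1 := Rlt_le_trans _ _ _ Bm (Rmin_l _ _)).
  assert (Bm' := Rlt_le_trans _ _ _ Bm (Rmin_r _ _)).
  assert (Bm2 := Rlt_le_trans _ _ _ Bm' (Rmin_l _ _)).
  assert (Bm3 := Rlt_le_trans _ _ _ Bm' (Rmin_r _ _)).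
  replace (f l - y)%C with ((f l - f m) + (f m - y))%C by ring.
  eapply Rle_trans; [apply Cmod_triangle|].
  specialize (Hy' m Bm2 Hm).
  specialize (Hf l m Hl Hm Bl ltac:(lra)).
  assert (Cmod (l - m)%C <= Cmod (l - z)%C + Cmod (m - z)%C).
  { replace (l - m)%C with ((l - z) + - (m - z))%C by ring.
    eapply Rle_trans; [apply Cmod_triangle|]. rewrite Cmod_opp. lra. }
  assert (c * Cmod (m - z)%C <= eps / 2).
  { apply Rle_trans with ((c + 1) * (eps / (2 * (c + 1)))).
    - apply Rmult_le_compat; auto using Cmod_ge_0; lra.
    - right; field; lra. }
  nra.
Qed.

(* The difference quotients in [lam] of the solutions are Lipschitz in [lam], together with
   their x-derivatives, and their second x-derivatives are bounded; so the first-order Taylor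
   estimate in [x] survives the limit [lam -> lam0]. *)
Lemma ex_cderiv_C_derive_parameter (q : R -> R) (Y V : C -> R -> C) (Q : R) (lam0 : C) (x0 : R) :
  (forall x, I01 x -> Rabs (q x) <= Q) ->
  (forall lam, second_order (Y lam) (V lam) (fun x => (RtoC (q x) - lam) * Y lam x)%C) ->
  (forall lam, Y lam 0 = Y lam0 0) -> (forall lam, V lam 0 = V lam0 0) ->
  I01 x0 ->
  exists l, cderiv (fun x => C_derive (fun lam => Y lam x) lam0) x0 l.
Proof.
  intros HQ HY Y0 V0 I0.
  (* A bound for [|q - lam|] that is uniform over the unit disc around [lam0]. *)
  set (M := Q + Cmod lam0 + 1).
  assert (Q0 : 0 <= Q) by (eapply Rle_trans; [apply Rabs_pos|apply (HQ x0 I0)]).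
  assert (HM : 0 <= M) by (unfold M; generalize (Cmod_ge_0 lam0); lra).
  assert (Hq : forall lam x, Cmod (lam - lam0)%C <= 1 -> I01 x ->
    Cmod (RtoC (q x) - lam)%C <= M).
  { intros lam x Hlam Hx.
    replace (RtoC (q x) - lam)%C with (RtoC (q x) + - lam0 + - (lam - lam0))%C by ring.
    generalize (Cmod_triangle (RtoC (q x) + - lam0) (- (lam - lam0)))
      (Cmod_triangle (RtoC (q x)) (- lam0)) (HQ x Hx).
    rewrite !Cmod_opp, Cmod_R. unfold M. lra. }
  set (K := exp (M + 2)).
  assert (HK : 1 < K) by (unfold K; rewrite <- exp_0; apply exp_increasing; lra).
  (* A uniform bound for [|Y|]: Gronwall bounds [|Y|^2], and [|Y| <= |Y|^2 + 1] avoids a square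
     root. *)
  set (N := (Cmod (Y lam0 0) ^ 2 + Cmod (V lam0 0) ^ 2) * K + 1).
  assert (HN : 0 <= N).
  { generalize (pow2_ge_0 (Cmod (Y lam0 0))) (pow2_ge_0 (Cmod (V lam0 0))).
    unfold N. intros. nra. }
  assert (BY : forall lam x, Cmod (lam - lam0)%C <= 1 -> I01 x -> Cmod (Y lam x) <= N).
  { intros lam x Hlam Hx.
    assert (G := gronwall _ _ _ M 0 (HY lam) HM (Rle_refl 0)).
    specialize (G ltac:(intros t Ht; rewrite Rplus_0_r, Cmod_mult;
      apply Rmult_le_compat_r; [apply Cmod_ge_0|apply Hq; [exact Hlam|unfold I01; lra]]) x Hx).
    rewrite Y0, V0 in G. fold K in G. unfold N.
    generalize (pow2_ge_0 (Cmod (V lam x))) (pow2_ge_0 (Cmod (Y lam x) - 1)). nra. }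
  set (DY := fun lam x => ((Y lam x - Y lam0 x) / (lam - lam0))%C).
  set (DV := fun lam x => ((V lam x - V lam0 x) / (lam - lam0))%C).
  set (SD := fun lam => second_order_lincomb (/ (lam - lam0)) (- / (lam - lam0))
                         _ _ _ _ _ _ (HY lam) (HY lam0)).
  assert (EDY : forall lam x,
    (/ (lam - lam0) * Y lam x + - / (lam - lam0) * Y lam0 x)%C = DY lam x)
    by (intros; unfold DY, Cdiv; ring).
  assert (EDV : forall lam x,
    (/ (lam - lam0) * V lam x + - / (lam - lam0) * V lam0 x)%C = DV lam x)
    by (intros; unfold DV, Cdiv; ring).
  (* The difference quotient solves the equation at [lam0] with forcing term [- Y lam]. *)
  assert (EW : forall lam x, lam <> lam0 ->
    (/ (lam - lam0) * ((RtoC (q x) - lam) * Y lam x) +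
     - / (lam - lam0) * ((RtoC (q x) - lam0) * Y lam0 x))%C =
    ((RtoC (q x) - lam0) * DY lam x + - Y lam x)%C).
  { intros lam x Hlam. unfold DY. field. intro E. apply Hlam.
    replace lam with ((lam - lam0) + lam0)%C by ring. rewrite E. ring. }
  assert (Z0 : Cmod (lam0 - lam0)%C <= 1).
  { replace (lam0 - lam0)%C with (RtoC 0) by ring. rewrite Cmod_0. lra. }
  assert (I0' : I01 0) by (unfold I01; lra).
  assert (Zero : forall k u : C, (k * u + - k * u)%C = RtoC 0) by (intros; ring).
  (* The difference [Y l - Y m] solves the equation at [l] with forcing term [- Y m * (l - m)] and
     zero data. *)
  assert (LY : forall l m x, Cmod (l - lam0)%C <= 1 -> Cmod (m - lam0)%C <= 1 -> I01 x ->
    Cmod (Y l x - Y m x)%C <= N * Cmod (l - m)%C * K).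
  { intros l m x Hl Hm Hx.
    replace (Y l x - Y m x)%C with (1 * Y l x + - (1) * Y m x)%C by ring.
    apply (gronwall_zero _ _ _ M (N * Cmod (l - m)%C)
      (second_order_lincomb 1 (- (1)) _ _ _ _ _ _ (HY l) (HY m))); auto.
    - apply Rmult_le_pos; auto using Cmod_ge_0.
    - intros t Ht. assert (It : I01 t) by (unfold I01; lra).
      replace (1 * ((RtoC (q t) - l) * Y l t) + - (1) * ((RtoC (q t) - m) * Y m t))%C with
        ((RtoC (q t) - l) * (1 * Y l t + - (1) * Y m t) + - (Y m t * (l - m)))%C by ring.
      eapply Rle_trans; [apply Cmod_triangle|]. rewrite Cmod_opp, !Cmod_mult.
      apply Rplus_le_compat; apply Rmult_le_compat_r; auto using Cmod_ge_0.
    - cbv beta. rewrite (Y0 l), (Y0 m). apply Zero.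
    - cbv beta. rewrite (V0 l), (V0 m). apply Zero. }
  assert (BD : forall l x, l <> lam0 -> Cmod (l - lam0)%C <= 1 -> I01 x -> Cmod (DY l x) <= N * K).
  { intros l x Hl Hl1 Hx. rewrite <- EDY.
    apply (gronwall_zero _ _ _ M N (SD l)); auto.
    - intros t Ht. assert (It : I01 t) by (unfold I01; lra). cbv beta.
      rewrite EW, EDY by exact Hl.
      eapply Rle_trans; [apply Cmod_triangle|]. rewrite Cmod_opp, Cmod_mult.
      apply Rplus_le_compat; [apply Rmult_le_compat_r|]; auto using Cmod_ge_0.
    - cbv beta. rewrite (Y0 l). apply Zero.
    - cbv beta. rewrite (V0 l). apply Zero. }
  (* One factor [K] comes from [LY], which bounds the forcing term [- (Y l - Y m)] for
     [DY l - DY m]; the other comes from applying Gronwall again. *)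
  set (c := N * K * K).
  assert (Hc : 0 <= c) by (unfold c; repeat apply Rmult_le_pos; lra).
  assert (LD : forall l m x, l <> lam0 -> m <> lam0 ->
    Cmod (l - lam0)%C <= 1 -> Cmod (m - lam0)%C <= 1 -> I01 x ->
    Cmod (DY l x - DY m x)%C <= c * Cmod (l - m)%C /\
    Cmod (DV l x - DV m x)%C <= c * Cmod (l - m)%C).
  { intros l m x Hl Hm Hl1 Hm1 Hx.
    replace (DY l x - DY m x)%C with (1 * DY l x + - (1) * DY m x)%C by ring.
    replace (DV l x - DV m x)%C with (1 * DV l x + - (1) * DV m x)%C by ring.
    replace (c * Cmod (l - m)%C) with (N * Cmod (l - m)%C * K * K) by (unfold c; ring).
    rewrite <- !EDY, <- !EDV.
    apply (gronwall_zero _ _ _ M (N * Cmod (l - m)%C * K)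
      (second_order_lincomb 1 (- (1)) _ _ _ _ _ _ (SD l) (SD m))); auto.
    - repeat apply Rmult_le_pos; auto using Cmod_ge_0; lra.
    - intros t Ht. assert (It : I01 t) by (unfold I01; lra). cbv beta.
      rewrite !EW, !EDY by assumption.
      replace (1 * ((RtoC (q t) - lam0) * DY l t + - Y l t)
               + - (1) * ((RtoC (q t) - lam0) * DY m t + - Y m t))%C with
        ((RtoC (q t) - lam0) * (1 * DY l t + - (1) * DY m t) + - (Y l t - Y m t))%C by ring.
      eapply Rle_trans; [apply Cmod_triangle|]. rewrite Cmod_opp, Cmod_mult.
      apply Rplus_le_compat; [apply Rmult_le_compat_r|]; auto using Cmod_ge_0.
    - cbv beta. rewrite (Y0 l), (Y0 m), !Zero. ring.
    - cbv beta. rewrite (V0 l), (V0 m), !Zero. ring. }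
  (* Bounds the second [x]-derivative of every [DY l], by [EW], [BD] and [BY]. *)
  set (B := M * (N * K) + N).
  assert (HB : 0 <= B) by (unfold B; assert (0 <= M * (N * K))
    by (repeat apply Rmult_le_pos; lra); lra).
  set (y' := fun x => C_derive (fun lam => Y lam x) lam0).
  (* The candidate derivative at [x0] is the limit of the [x]-derivatives of the difference
     quotients. *)
  set (v := C_lim (fun lam => DV lam x0) lam0).
  assert (T : forall x, I01 x ->
    Cmod (y' x - y' x0 - RtoC (x - x0) * v)%C <= 4 * B * (x - x0) ^ 2).
  { intros x Hx. apply le_epsilon. intros eps He.
    (* Replacing the limits at [x], at [x0] and in the slope by quotients at [lam0 + t] costs at
       most [c * t] each, hence [3 * c * t <= eps] in all. *)
    set (t := Rmin 1 (eps / (3 * c + 1))).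
    assert (Ht : 0 < t <= 1 /\ 3 * c * t <= eps).
    { assert (0 < eps / (3 * c + 1)) by (apply Rdiv_lt_0_compat; lra).
      assert (0 < t) by (apply Rmin_glb_lt; lra).
      assert (t <= 1) by apply Rmin_l.
      assert (t <= eps / (3 * c + 1)) by apply Rmin_r.
      split; [lra|]. apply Rle_trans with ((3 * c + 1) * (eps / (3 * c + 1))).
      - apply Rmult_le_compat; lra.
      - right; field; lra. }
    destruct Ht as [Ht Hct].
    set (lam := (lam0 + RtoC t)%C).
    assert (El : (lam - lam0)%C = RtoC t) by (unfold lam; ring).
    assert (Cl : Cmod (lam - lam0)%C = t) by (rewrite El, Cmod_R, Rabs_right; lra).
    assert (Hl : lam <> lam0).
    { intro E. rewrite E in Cl. replace (lam0 - lam0)%C with (RtoC 0) in Cl by ring.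
      rewrite Cmod_0 in Cl. lra. }
    assert (Hl1 : Cmod (lam - lam0)%C <= 1) by lra.
    assert (A1 : Cmod (DY lam x - y' x)%C <= c * t).
    { rewrite <- Cl. apply (C_lim_of_lipschitz (fun l => DY l x)); auto. intros; now apply LD. }
    assert (A2 : Cmod (DY lam x0 - y' x0)%C <= c * t).
    { rewrite <- Cl. apply (C_lim_of_lipschitz (fun l => DY l x0)); auto. intros; now apply LD. }
    assert (A3 : Cmod (DV lam x0 - v)%C <= c * t).
    { rewrite <- Cl. apply (C_lim_of_lipschitz (fun l => DV l x0)); auto. intros; now apply LD. }
    assert (A4 : Cmod (DY lam x - DY lam x0 - RtoC (x - x0) * DV lam x0)%C
                 <= 4 * B * (x - x0) ^ 2).
    { rewrite <- !EDY, <- EDV. apply (second_order_taylor _ _ _ B x0 x (SD lam)); auto.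
      intros r Hr. assert (Ir : I01 r) by (unfold I01; lra). cbv beta. rewrite EW by exact Hl.
      eapply Rle_trans; [apply Cmod_triangle|]. rewrite Cmod_opp, Cmod_mult. unfold B.
      apply Rplus_le_compat; [apply Rmult_le_compat|]; auto using Cmod_ge_0. }
    replace (y' x - y' x0 - RtoC (x - x0) * v)%C with
      ((DY lam x - DY lam x0 - RtoC (x - x0) * DV lam x0) + (RtoC (x - x0) * (DV lam x0 - v))
       + (DY lam x0 - y' x0) + - (DY lam x - y' x))%C by ring.
    assert (A5 : Cmod (RtoC (x - x0) * (DV lam x0 - v))%C <= c * t).
    { rewrite Cmod_mult, Cmod_R.
      assert (Rabs (x - x0) <= 1) by (unfold I01 in *; apply Rabs_le; lra).
      generalize (Cmod_ge_0 (DV lam x0 - v)%C) (Rabs_pos (x - x0)). nra. }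
    rewrite <- (Cmod_opp (DY lam x - y' x)) in A1.
    match goal with |- Cmod (?z1 + ?z2 + ?z3 + ?z4)%C <= _ =>
      generalize (Cmod_triangle (z1 + z2 + z3) z4) (Cmod_triangle (z1 + z2) z3)
        (Cmod_triangle z1 z2) end.
    lra. }
  (* With this radius the quadratic error [4 * B * |z - x0|^2] is at most [eps * |z - x0|]. *)
  exists v. intros eps He. exists (eps / (4 * B + 1)). split; [apply Rdiv_lt_0_compat; lra|].
  intros z Iz Hz. eapply Rle_trans; [apply T, Iz|].
  rewrite <- (pow2_abs (z - x0)).
  assert ((4 * B + 1) * Rabs (z - x0) <= eps).
  { apply Rle_trans with ((4 * B + 1) * (eps / (4 * B + 1))).
    - apply Rmult_le_compat_l; lra.
    - right; field; lra. }
  generalize (Rabs_pos (z - x0)). nra.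
Qed.

(** * The boundary functional *)

Lemma continuous_on_I01_bounded (q : R -> R) :
  continuous_on I01 q -> exists Q, forall x, I01 x -> Rabs (q x) <= Q.
Proof.
  intros H. apply rcontinuous_bounded, rcontinuous_intro. intros x Hx eps He.
  destruct (H x Hx _ (locally_ball (q x) (mkposreal eps He))) as [d Hd].
  exists d; split; [apply cond_pos|]. intros z Iz Hz. exact (Hd z Hz Iz).
Qed.

Lemma is_solution_second_order q lam u : is_solution q lam u ->
  second_order u (deriv01 u) (fun x => (RtoC (q x) - lam) * u x)%C.
Proof.
  intros [Hd He]. split; [|split].
  - intros x Hx. apply ex_deriv01_cderiv; [exact Hx|apply Hd, Hx].
  - intros x Hx. exists (deriv01 (deriv01 u) x).
    apply ex_deriv01_cderiv; [exact Hx|apply Hd, Hx].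
  - intros x Hx. assert (Ix : I01 x) by (unfold I01; lra).
    replace ((RtoC (q x) - lam) * u x)%C with (deriv01 (deriv01 u) x).
    + apply ex_deriv01_cderiv; [exact Ix|apply Hd, Ix].
    + specialize (He x Hx).
      transitivity (RtoC (q x) * u x - (- deriv01 (deriv01 u) x + RtoC (q x) * u x))%C; [ring|].
      rewrite He. ring.
Qed.

(** Zero data at 1 would propagate back to 0, contradicting [sin^2 + cos^2 = 1] for the initial
    data. *)
Lemma initial_solution_boundary_nonzero q beta y lam :
  continuous_on I01 q -> is_initial_solution q beta y ->
  y 1 lam = RtoC 0 -> deriv01 (fun x => y x lam) 1 = RtoC 0 -> False.
Proof.
  intros Hq Hy H1 H2. destruct (continuous_on_I01_bounded q Hq) as [Q HQ].
  destruct (Hy lam) as [Hs [Hsin Hcos]].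
  assert (Q0 : 0 <= Q) by (eapply Rle_trans; [apply Rabs_pos|apply (HQ 0); unfold I01; lra]).
  destruct (backward_uniqueness _ _ _ (Q + Cmod lam) (is_solution_second_order _ _ _ Hs))
    as [E1 E2]; auto.
  - generalize (Cmod_ge_0 lam). lra.
  - intros x Hx. rewrite Cmod_mult. apply Rmult_le_compat_r; [apply Cmod_ge_0|].
    replace (RtoC (q x) - lam)%C with (RtoC (q x) + - lam)%C by ring.
    eapply Rle_trans; [apply Cmod_triangle|]. rewrite Cmod_opp, Cmod_R.
    apply Rplus_le_compat_r, HQ. unfold I01; lra.
  - rewrite E1 in Hsin. rewrite E2 in Hcos.
    apply RtoC_inj in Hsin. apply RtoC_inj in Hcos.
    generalize (sin2_cos2 beta). rewrite <- Hsin, <- Hcos. unfold Rsqr. lra.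
Qed.

(** The initial data [sin beta] and [cos beta] do not depend on [lam], so difference quotients have
    zero data at 0. *)
Lemma ex_cderiv_y_1tilde q beta y lam0 x :
  continuous_on I01 q -> is_initial_solution q beta y -> I01 x ->
  exists l, cderiv (y_1tilde y lam0) x l.
Proof.
  intros Hq Hy Hx. destruct (continuous_on_I01_bounded q Hq) as [Q HQ].
  apply (ex_cderiv_C_derive_parameter q (fun lam t => y t lam)
    (fun lam => deriv01 (fun t => y t lam)) Q lam0 x HQ).
  - intros lam. apply is_solution_second_order, Hy.
  - intros lam. destruct (Hy lam) as [_ [-> _]]. now destruct (Hy lam0) as [_ [-> _]].
  - intros lam. destruct (Hy lam) as [_ [_ ->]]. now destruct (Hy lam0) as [_ [_ ->]].
  - exact Hx.
Qed.

Local Open Scope C_scope.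

Lemma frakA0_nonzero q a b c d beta y lam0 :
  continuous_on I01 q -> (a * d - b * c < 0)%R -> is_initial_solution q beta y ->
  omega a b c d y lam0 = 0 -> frakA0 a b c d lam0 (y_0 y lam0) <> 0.
Proof.
  intros Hq Hdet Hy Hw. unfold omega in Hw. unfold frakA0.
  destruct (Ceq_dec (c * lam0 + d) 0) as [E|E].
  - assert (Hab : a * lam0 + b <> 0).
    (* The combination [a * (c * lam0 + d) - c * (a * lam0 + b)] equals [a * d - b * c], so the two
       coefficients cannot vanish together. *)
    { intro E'. assert (D : RtoC (a * d - b * c)%R = 0).
      { rewrite RtoC_minus, !RtoC_mult.
        transitivity (a * (c * lam0 + d) - c * (a * lam0 + b)); [ring|]. rewrite E, E'. ring. }
      apply RtoC_inj in D. lra. }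
    rewrite E in Hw.
    assert (H1 : y 1%R lam0 = 0).
    { destruct (Ceq_dec (y 1%R lam0) 0) as [H|H]; [exact H|].
      destruct (Cmult_neq_0 _ _ Hab H). rewrite <- Hw. ring. }
    intro H. apply (initial_solution_boundary_nonzero q beta y lam0 Hq Hy H1).
    change (deriv01 (y_0 y lam0) 1 = 0).
    transitivity ((a * lam0 + b) * (deriv01 (y_0 y lam0) 1 / (a * lam0 + b))); [now field|].
    rewrite H. ring.
  (* Here a vanishing functional gives [y(1) = 0], and [omega = 0] then gives [y'(1) = 0]; in the
     other case the roles are exchanged. *)
  - intro H.
    assert (H1 : y 1%R lam0 = 0).
    { transitivity ((c * lam0 + d) * (y_0 y lam0 1%R / (c * lam0 + d)));
        [unfold y_0; now field|]. rewrite H. ring. }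
    apply (initial_solution_boundary_nonzero q beta y lam0 Hq Hy H1).
    destruct (Ceq_dec (deriv01 (fun x => y x lam0) 1) 0) as [H'|H']; [exact H'|].
    destruct (Cmult_neq_0 _ _ E H').
    transitivity ((a * lam0 + b) * y 1%R lam0); [|rewrite H1; ring].
    transitivity ((a * lam0 + b) * y 1%R lam0 - 0); [|ring]. rewrite <- Hw. ring.
Qed.

(** The correction term of [frakA1] is independent of [u] and cancels. The shift [l] is used with
    [K] for [y_1hat] and with the constant [C_2] for [y_1sharp]. *)
Lemma frakA1_shift q a b c d beta y lam0 (k l : C) :
  continuous_on I01 q -> is_initial_solution q beta y ->
  frakA1 a b c d lam0 (y_0 y lam0) (fun x => y_1tilde y lam0 x + (k + l) * y_0 y lam0 x) =
  frakA1 a b c d lam0 (y_0 y lam0) (fun x => y_1tilde y lam0 x + k * y_0 y lam0 x)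
  + l * frakA0 a b c d lam0 (y_0 y lam0).
Proof.
  intros Hq Hy.
  assert (I1 : I01 1) by (unfold I01; lra).
  destruct (ex_cderiv_y_1tilde q beta y lam0 1 Hq Hy I1) as [v Hv].
  assert (H0 : cderiv (y_0 y lam0) 1 (deriv01 (y_0 y lam0) 1)).
  { apply ex_deriv01_cderiv; [exact I1|]. now apply (proj1 (proj1 (Hy lam0))). }
  assert (D : forall k, deriv01 (fun x => y_1tilde y lam0 x + k * y_0 y lam0 x) 1 =
    v + k * deriv01 (y_0 y lam0) 1).
  { intro k'. apply deriv01_unique; [exact I1|].
    apply cderiv_plus; [exact Hv|]. now apply cderiv_scal. }
  unfold frakA1, frakA0. destruct (Ceq_dec (c * lam0 + d) 0).
  - rewrite !D. unfold Cdiv. ring.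
  - unfold Cdiv. ring.
Qed.

Theorem theorem3p2 :
  forall (q : R -> R) (a b c d beta : R) (y : R -> C -> C) (lam0 K : C),
    continuous_on I01 q ->
    (a * d - b * c < 0)%R ->
    (0 <= beta < PI)%R ->
    is_initial_solution q beta y ->
    triple_eigenvalue a b c d y lam0 ->
    frakA1 a b c d lam0 (y_0 y lam0) (y_1sharp a b c d y lam0 K) = 0 <->
    K = - (C_derive_n (omega a b c d y) 4 lam0
           / (4 * C_derive_n (omega a b c d y) 3 lam0)).
Proof.
  intros q a b c d beta y lam0 K Hq Hdet _ Hy [Hw [_ [_ H3]]].
  set (C2 := C_2 a b c d y lam0 K).
  set (A0 := frakA0 a b c d lam0 (y_0 y lam0)).
  set (w3 := C_derive_n (omega a b c d y) 3 lam0) in *.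
  set (w4 := C_derive_n (omega a b c d y) 4 lam0).
  assert (HA0 : A0 <> 0) by exact (frakA0_nonzero q a b c d beta y lam0 Hq Hdet Hy Hw).
  set (A1 := frakA1 a b c d lam0 (y_0 y lam0) (y_1 y lam0 K)).
  assert (Ehat : frakA1 a b c d lam0 (y_0 y lam0) (y_1hat y lam0 K) = A1 + K * A0).
  { unfold A1, A0. unfold y_1 at 1. rewrite <- (frakA1_shift q a b c d beta) by assumption.
    f_equal. apply functional_extensionality. intros x. unfold y_1hat, y_1. ring. }
  assert (Esharp : frakA1 a b c d lam0 (y_0 y lam0) (y_1sharp a b c d y lam0 K) = A1 + C2 * A0).
  { unfold A1, A0. unfold y_1 at 1. rewrite <- (frakA1_shift q a b c d beta) by assumption.
    f_equal. apply functional_extensionality. intros x. unfold y_1sharp, y_1. fold C2. ring. }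
  assert (N : forall r : R, r <> 0%R -> RtoC r <> 0) by (intros r Hr E; now apply RtoC_inj in E).
  (* Multiplying [C_2] by [A0] gives [- (A1 + K * A0) - A0 * w4 / (4 * w3)], so [A1] cancels; the 4
     is [24 / 6]. *)
  assert (EC2 : A1 + C2 * A0 = - A0 * (K + w4 / (4 * w3))).
  { unfold C2, C_2. fold w3 w4 A0. rewrite Ehat.
    field. repeat split; try assumption; apply N; lra. }
  rewrite Esharp, EC2. split.
  - intro H. destruct (Ceq_dec (K + w4 / (4 * w3)) 0) as [E|E].
    + transitivity (K + w4 / (4 * w3) - w4 / (4 * w3)); [ring|]. rewrite E. ring.
    + destruct (Cmult_neq_0 _ _ HA0 E).
      transitivity (- (- A0 * (K + w4 / (4 * w3)))); [ring|]. rewrite H. ring.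
  - intros ->. ring.
Qed.
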